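(* Let $\epsilon\in[0,1]$ be fixed. Given positive integers $n,m$ and oracle access to a function $f:[n]\to[m]$, the quantum query complexity of determining whether $\mathcal{P}_f$ is uniform or $\epsilon$-far from uniform is $\Omega(m^{1/3})$. That is, if $A$ is a quantum algorithm that for every $f:[n]\to[m]$ decides, with success probability at least $2/3$, whether $\mathcal{P}_f=U$ or $\|\mathcal{P}_f-U\|_1\ge\epsilon$ (under the promise that one of these two cases holds), then $A$ makes $\Omega(m^{1/3})$ queries to $f$.
   Context: Notation: $[n]=\{1,\dots,n\}$. For $f:[n]\to[m]$, $\mathcal{P}_f$ is the probability distribution on $[m]$ given by $\mathcal{P}_f(j)=|f^{-1}(j)|/n$. $U$ denotes the uniform distribution on $[m]$, and $\mathcal{P}_f$ is $\epsilon$-far from uniform if $\|\mathcal{P}_f-U\|_1=\sum_{j=1}^m|\mathcal{P}_f(j)-1/m|\ge\epsilon$. Quantum oracle access to $f$ means access to the unitary $|x\rangle|b\rangle\mapsto|x\rangle|b\oplus f(x)\rangle$ ($x$ a $\log n$-bit string, $b,f(x)$ being $\log m$-bit strings, $\oplus$ bitwise addition modulo two); one application is one query. The tester receives $n$ and $m$ as part of its input and must be correct for all $n$, $m$ and all $f:[n]\to[m]$ satisfying the promise; the lower bound concerns the worst-case number of queries, over $n$ and $f$, as a function of $m$ (for $m\to\infty$). *)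

(* Defs.v *)
From HB Require Import structures.
From mathcomp Require Import all_boot all_order all_algebra.
From mathcomp Require Import complex spectral.
From mathcomp Require Import reals exp.

Set Implicit Arguments.
Unset Strict Implicit.
Unset Printing Implicit Defensive.

Import Order.TTheory GRing.Theory Num.Theory.
Local Open Scope ring_scope.

Definition fdist (R : realType) (n m : nat) (f : 'I_n -> 'I_m) :
    {ffun 'I_m -> R} :=
  [ffun j => #|[set i | f i == j]|%:R / n%:R].

Definition udist (R : realType) (m : nat) : {ffun 'I_m -> R} :=
  [ffun=> m%:R^-1].

Definition l1dist (R : realType) (m : nat) (p q : {ffun 'I_m -> R}) : R :=
  \sum_j `|p j - q j|.

Definition bits (k : nat) := {ffun 'I_k -> bool}.

Definition bxor (k : nat) (a b : bits k) : bits k :=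
  [ffun i => a i (+) b i].

(* Little-endian binary expansion, truncated to [k] bits; it is injective on
   {0, ..., 2^k - 1}. *)
Definition nbits (k i : nat) : bits k := [ffun j : 'I_k => odd (i %/ 2 ^ j)].

(* Computational basis |x>|b>|w>: a query register of ceil(log2 n) qubits, an
   answer register of ceil(log2 m) qubits and [w] workspace qubits. *)
Definition basis (n m w : nat) : finType :=
  (bits (up_log 2 n) * bits (up_log 2 m) * bits w)%type.

(* Action of a query on basis states, |x>|b>|w> |-> |x>|b (+) f x>|w>.
   When n is not a power of two, the strings x that encode no element of
   the domain are left unchanged. *)
Definition query (n m w : nat) (f : 'I_n -> 'I_m) (s : basis n m w) :
    basis n m w :=
  let: (x, b, v) := s in
  (x,
   if [pick i : 'I_n | nbits (up_log 2 n) i == x] is Some i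
   then bxor b (nbits (up_log 2 m) (f i)) else b,
   v).

(* Operators and states are matrices and column vectors whose coordinates are
   indexed by basis states through [enum_val] / [enum_rank]. *)
Definition oracle (R : realType) (n m w : nat) (f : 'I_n -> 'I_m) :
    'M[R[i]]_#|basis n m w| :=
  \matrix_(s, t) (enum_val s == query f (enum_val t))%:R.

(* Only the gates 0, ..., [nqueries] are used; the final computational-basis
   measurement answers "uniform" on the outcomes in [accept]. *)
Record qalg (R : realType) (n m : nat) := QAlg {
  nqueries : nat;
  nwork : nat;
  gate : nat -> 'M[R[i]]_#|basis n m nwork|;
  gate_unitary : forall t, gate t \is unitarymx;
  accept : {set basis n m nwork}
}.

Definition zero_state (n m w : nat) : basis n m w :=
  ([ffun=> false], [ffun=> false], [ffun=> false]).

(* State after [t] queries: U_t O_f U_(t-1) O_f ... O_f U_0 |0>. *)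
Fixpoint qstate (R : realType) (n m : nat) (A : qalg R n m)
    (f : 'I_n -> 'I_m) (t : nat) : 'cV[R[i]]_#|basis n m (nwork A)| :=
  if t is t'.+1 then gate A t *m (oracle R (nwork A) f *m qstate A f t')
  else gate A 0 *m delta_mx (enum_rank (zero_state n m (nwork A))) 0.

Definition outcome_prob (R : realType) (n m : nat) (A : qalg R n m)
    (f : 'I_n -> 'I_m) (S : {set basis n m (nwork A)}) : R[i] :=
  \sum_(s in S) `|qstate A f (nqueries A) (enum_rank s) 0| ^+ 2.

(* The order on R[i] compares real parts of numbers with equal imaginary
   parts; the probabilities below have imaginary part 0. *)
Definition decides_uniformity (R : realType) (eps : R) (n m : nat)
    (A : qalg R n m) : Prop :=
  forall f : 'I_n -> 'I_m,
    (fdist R f = udist R m -> 2 / 3 <= outcome_prob f (accept A)) /\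
    (eps <= l1dist (fdist R f) (udist R m) ->
       2 / 3 <= outcome_prob f (~: accept A)).

(* A tester gets n and m as input, hence is a family of circuits indexed by
   n and m. *)
Definition uniformity_tester (R : realType) (eps : R)
    (A : forall n m : nat, qalg R n m) : Prop :=
  forall n m : nat, (0 < n)%N -> (0 < m)%N -> decides_uniformity eps (A n m).

(* Main.v *)
(** Polynomial method, with [n := m`!].  For [r <= m], call a function regular
   of range [r] if it takes exactly [r] values, each of them [n / r] times: for
   [r = m] these are the functions with uniform distribution, and for
   [r <= m / 2] they are at distance [2 (1 - r / m) >= 1] from uniform.  After
   [q] queries the acceptance probability has degree at most [2q] in the
   indicators [f x = y], and the proportion of regular functions of range [r]
   extending a partial function with [k] entries is a polynomial of degree at
   most [k] in [1 / r]; so the mean acceptance probability over these functions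
   is [p(1/r)] with [p] of degree at most [d = 2q + 1].  Such a [p] takes values
   in [[0, 1]] at all [1/r], [1 <= r <= m], and drops by [1/3] between [1/m]
   and [1/(m/2)].  Lagrange interpolation of [(p - p(1/m)) / (X - 1/m)] at the
   [d] points [1/r_i], [r_i ~ 4 d^3 / i^2], bounds that drop by
   [O(d^3 / m)]. *)

Require Import Defs.
From mathcomp Require Import all_boot all_order all_algebra.
From mathcomp Require Import perm.
From mathcomp Require Import complex spectral.
From mathcomp Require Import reals sequences exp.
From mathcomp Require Import zify ring lra.
Import Order.TTheory GRing.Theory Num.Theory.
Local Open Scope ring_scope.

Set Implicit Arguments.
Unset Strict Implicit.
Unset Printing Implicit Defensive.

(** * Lagrange interpolation and the bound on the drop *)

Lemma lagrange_eval (F : fieldType) (d : nat) (z : 'I_d -> F) (q : {poly F})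
    (x : F) : injective z -> (size q <= d)%N ->
  q.[x] = \sum_i q.[z i] * \prod_(j | j != i) ((x - z j) / (z i - z j)).
Proof.
move=> z_inj szq.
pose L : {poly F} := \sum_i q.[z i] *:
  \prod_(j | j != i) ((z i - z j)^-1 *: ('X - (z j)%:P)).
have LE y : L.[y] =
    \sum_i q.[z i] * \prod_(j | j != i) ((y - z j) / (z i - z j)).
  rewrite horner_sum; apply: eq_bigr => i _.
  rewrite hornerZ horner_prod; congr (_ * _); apply: eq_bigr => j _.
  by rewrite !hornerE mulrC.
have szL : (size L <= d)%N.
  rewrite (leq_trans (size_sum _ _ _)) //; apply/bigmax_leqP => i _.
  rewrite (leq_trans (size_scale_leq _ _)) //.
  rewrite (leq_trans (size_poly_prod_leq _ _)) // leq_subLR.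
  rewrite (@leq_trans (\sum_(j | j != i) 2).+1) // ?ltnS.
    apply: leq_sum => j _; rewrite (leq_trans (size_scale_leq _ _)) //.
    by rewrite size_XsubC.
  rewrite sum_nat_const.
  have := cardC1 i; rewrite card_ord => cE.
  have -> : #|[pred j | j != i]| = d.-1 by rewrite -cE; apply: eq_card => j.
  by have := ltn_ord i; lia.
suff qL : q = L by rewrite {1}qL LE.
apply/eqP; rewrite -subr_eq0; apply/eqP.
apply: (@roots_geq_poly_eq0 _ _ [seq z i | i <- enum 'I_d]).
- apply/allP => _ /mapP[i _ ->]; rewrite rootE hornerD hornerN LE.
  rewrite (bigD1 i) //= [X in _ - (_ + X)]big1 => [|j j_i]; last first.
    by rewrite (bigD1 i) 1?eq_sym //= subrr mul0r mul0r mulr0.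
  rewrite addr0 big1 ?mulr1 ?subrr // => j j_i.
  by rewrite divff // subr_eq0 (inj_eq z_inj) eq_sym.
- by rewrite map_inj_uniq ?enum_uniq.
- rewrite size_map size_enum_ord (leq_trans (size_polyD _ _)) //.
  by rewrite size_polyN geq_max szq szL.
Qed.

(* For the nodes [z_j] proportional to [j^2], this is the absolute value at [0]
   of the [i]-th Lagrange basis polynomial. *)
Lemma prod_square_nodes (R : realFieldType) (d i : nat) : (0 < i <= d)%N ->
  \prod_(1 <= j < d.+1 | j != i) (j%:R ^+ 2 / `|j%:R ^+ 2 - i%:R ^+ 2|)
  = 2 * (d`!%:R ^+ 2 / ((d - i)`!%:R * (d + i)`!%:R)) :> R.
Proof.
(* Induction on [d - i]. For [d = i] every factor has [j < i] and [i^2 - j^2] splits as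
   [(i - j)(i + j)]; each further step appends one factor with [j > i]. *)
case/andP=> i0 /subnKC <-; elim: (d - i)%N => [|k IHk].
  rewrite addn0 subnn big_mkcond big_nat_recr //= eqxx mulr1 -big_mkcond /=.
  have -> : \prod_(1 <= j < i | j != i) (j%:R ^+ 2 / `|j%:R ^+ 2 - i%:R ^+ 2|)
      = \prod_(1 <= j < i) (j%:R ^+ 2 / ((i - j)%:R * (i + j)%:R)) :> R.
    rewrite big_nat_cond [RHS]big_nat_cond.
    apply: eq_big => [j|j /andP[/andP[_ ji] _]]; first by lia.
    rewrite distrC ger0_norm; last first.
      by rewrite subr_ge0 lerXn2r ?nnegrE ?ler0n ?ler_nat 1?ltnW.
    by rewrite subr_sqr natrB 1?ltnW // natrD.
  (* Closed form of the partial products, for an induction on [k]; the case needed is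
     [k = i - 1]. *)
  have prE k : (k < i)%N -> \prod_(1 <= j < k.+1)
      (j%:R ^+ 2 / ((i - j)%:R * (i + j)%:R)) =
      k`!%:R ^+ 2 * ((i - k.+1)`!%:R / (i.-1)`!%:R) *
        (i`!%:R / (i + k)`!%:R) :> R.
    elim: k => [_|k IHk ki].
      rewrite big_nil subn1 addn0 fact0 expr1n mul1r.
      by rewrite !divff ?mulr1 ?pnatr_eq0 -?lt0n ?fact_gt0.
    rewrite big_nat_recr //= IHk 1?ltnW // addnS !factS.
    have -> : (i - k.+1 = (i - k.+2).+1)%N by lia.
    rewrite factS !natrM; field.
    by rewrite -!natrD !nat1r !pnatr_eq0 -!lt0n !fact_gt0.
  case: i i0 prE => // i _ /(_ i (ltnSn i)) ->.
  rewrite subnn fact0 /= addnS.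
  have -> : (i.+1 + i).+1`! = (2 * i.+1 * (i.+1 + i)`!)%N.
    by rewrite factS; congr (_ * _)%N; lia.
  have := fact_gt0 (i.+1 + i); move: (_ + i)`! => u u0.
  rewrite factS !natrM; field.
  by rewrite !nat1r !pnatr_eq0 -!lt0n u0 !fact_gt0.
rewrite addnS big_mkcond big_nat_recr; last by lia.
rewrite -big_mkcond /= IHk ifT; last by lia.
rewrite ger0_norm; last first.
  by rewrite subr_ge0 lerXn2r ?nnegrE ?ler0n ?ler_nat; lia.
rewrite subr_sqr.
have -> : (i + k - i = k)%N by lia.
have -> : ((i + k).+1 - i = k.+1)%N by lia.
rewrite addSn !factS -natrB; last by lia.
have -> : ((i + k).+1 - i = k.+1)%N by lia.
rewrite -[(i + k).+1%:R + i%:R]natrD addSn !natrM; field.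
by rewrite -?natrD ?nat1r ?pnatr_eq0 -?lt0n ?fact_gt0.
Qed.

(** Passing from [i] to [i + 1] multiplies the left side by [1 - (2i+1)/(d+i+1)], which is at most
    [exp(-(2i+1)/(2d))]; the odd numbers [2k+1] with [k < i] add up to [i^2]. *)
Lemma central_ratio_le (R : realType) (d i : nat) : (i <= d)%N ->
  d`!%:R ^+ 2 / ((d - i)`!%:R * (d + i)`!%:R)
  <= expR (- (i%:R ^+ 2 / (2 * d%:R))) :> R.
Proof.
elim: i => [_|i IHi id].
  rewrite subn0 addn0 expr2 divff ?expr0n ?mul0r ?oppr0 ?expR0 //.
  by rewrite mulf_neq0 ?pnatr_eq0 -?lt0n ?fact_gt0.
have fR k : k`!%:R != 0 :> R by rewrite pnatr_eq0 -lt0n fact_gt0.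
have d0 : 0 < d%:R :> R by rewrite ltr0n; lia.
have -> : d`!%:R ^+ 2 / ((d - i.+1)`!%:R * (d + i.+1)`!%:R) =
    d`!%:R ^+ 2 / ((d - i)`!%:R * (d + i)`!%:R) *
    (1 + - ((2 * i + 1)%:R / (d + i.+1)%:R)) :> R.
  have di : (d - i = (d - i.+1).+1)%N by lia.
  have dE : (d - i.+1).+1%:R = d%:R - i%:R :> R by rewrite -di natrB // ltnW.
  have di0 : d%:R - i%:R != 0 :> R by rewrite -dE pnatr_eq0.
  rewrite di addnS !factS !natrM dE -[(d + i).+1%:R]natr1 !natrD; field.
  by rewrite !fR di0 -!natrD natr1 pnatr_eq0.
have -> : - (i.+1%:R ^+ 2 / (2 * d%:R)) = - (i%:R ^+ 2 / (2 * d%:R)) +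
    - ((2 * i + 1)%:R / (2 * d%:R)) :> R.
  by rewrite -natr1 natrD natrM; field; rewrite gt_eqF.
rewrite expRD ler_pM //; last 2 first.
- by apply: IHi; lia.
- apply: le_trans (expR_ge1Dx _) _; rewrite ler_expR lerN2.
  rewrite ler_pM2l ?ltr0n ?addn1 // lef_pV2 ?posrE ?mulr_gt0 ?ltr0n //;
    [|lia..].
  by rewrite -natrM ler_nat; lia.
- by rewrite divr_ge0 ?exprn_ge0 ?mulr_ge0 ?ler0n.
- by rewrite subr_ge0 ler_pdivrMr ?mul1r ?ler_nat ?ltr0n; lia.
Qed.

(** The floor is taken because [p] is controlled only at reciprocals of integers. The reciprocals,
    about [i^2 / (4 d^3)], cluster quadratically at [0], like Chebyshev points at an endpoint. *)
Definition node (d i : nat) : nat := (4 * d ^ 3 %/ i ^ 2)%N.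

Lemma node_le (R : realFieldType) (d i : nat) : (0 < i)%N ->
  (node d i)%:R <= 4 * d%:R ^+ 3 / i%:R ^+ 2 :> R.
Proof.
move=> i0; rewrite ler_pdivlMr ?exprn_gt0 ?ltr0n // -!natrX -!natrM ler_nat.
exact: leq_divM.
Qed.

Lemma node_gt (R : realFieldType) (d i : nat) : (0 < i)%N ->
  4 * d%:R ^+ 3 / i%:R ^+ 2 < (node d i)%:R + 1 :> R.
Proof.
move=> i0; rewrite ltr_pdivrMr ?exprn_gt0 ?ltr0n // natr1 -!natrX -!natrM.
by rewrite ltr_nat ltn_ceil // expn_gt0 i0.
Qed.

Lemma node_gt0 (d i : nat) : (0 < i <= d)%N -> (0 < node d i)%N.
Proof.
move=> /andP[i0 id]; rewrite divn_gt0 ?expn_gt0 ?i0 //.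
by apply: (@leq_trans (d ^ 2)); rewrite ?leq_sqr // expnS; nia.
Qed.

(* Rounding [4 d^3 / i^2] to an integer costs the last factor; the product of
   these factors over [j] is absorbed by the decay in [central_ratio_le]. *)
Lemma node_dist_ratio (R : realFieldType) (d i j : nat) :
  (0 < i <= d)%N -> (0 < j <= d)%N -> j != i ->
  node d j != node d i /\
  (node d i)%:R / `|(node d j)%:R - (node d i)%:R| <=
  j%:R ^+ 2 / `|j%:R ^+ 2 - i%:R ^+ 2| * (1 + i%:R ^+ 2 / (2 * d%:R ^+ 2)) :> R.
Proof.
move=> /andP[i0 id] /andP[j0 jd] ji.
have d0 : (0 < d)%N by exact: leq_trans id.
have := node_le R d i0; have := node_gt R d i0.
have := node_le R d j0; have := node_gt R d j0.
set ri := (node d i)%:R; set rj := (node d j)%:R.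
set a := _ / j%:R ^+ 2; set b := _ / i%:R ^+ 2 => a1 a2 b1 b2.
pose g := `|a - b|.
have I0 : 0 < i%:R ^+ 2 :> R by rewrite exprn_gt0 ?ltr0n.
have J0 : 0 < j%:R ^+ 2 :> R by rewrite exprn_gt0 ?ltr0n.
have D0 : 0 < d%:R :> R by rewrite ltr0n.
have gE : g =
    4 * d%:R ^+ 3 * `|j%:R ^+ 2 - i%:R ^+ 2| / (i%:R ^+ 2 * j%:R ^+ 2).
  have -> : g =
      `|4 * d%:R ^+ 3 * (i%:R ^+ 2 - j%:R ^+ 2) / (i%:R ^+ 2 * j%:R ^+ 2)|.
    by rewrite /g /a /b; congr `|_|; field; rewrite !pnatr_eq0 -!lt0n i0 j0.
  rewrite !normrM (distrC (i%:R ^+ 2)) ger0_norm ?ler0n //.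
  rewrite ger0_norm ?exprn_ge0 // [`|_^-1|]ger0_norm //.
  by rewrite invr_ge0 mulr_ge0 // ltW.
(* [|j - i| >= 1] and [j + i >= j]. *)
have sq : j%:R <= `|j%:R ^+ 2 - i%:R ^+ 2| :> R.
  have [lij|lij|eij] := ltngtP i j; last by rewrite eij eqxx in ji.
    rewrite ger0_norm; last by rewrite subr_ge0 -!natrX ler_nat; nia.
    by rewrite -!natrX -natrB ?ler_nat; nia.
  rewrite distrC ger0_norm; last by rewrite subr_ge0 -!natrX ler_nat; nia.
  by rewrite -!natrX -natrB ?ler_nat; nia.
have N0 : 0 < `|j%:R ^+ 2 - i%:R ^+ 2| :> R.
  by apply: lt_le_trans sq; rewrite ltr0n.
have gl : 4 * d%:R ^+ 2 / i%:R ^+ 2 <= g.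
  rewrite gE ler_pdivrMr // mulrAC ler_pdivlMr ?(mulr_gt0 I0 J0) //.
  suff : d%:R ^+ 2 * j%:R ^+ 2 <= d%:R ^+ 3 * `|j%:R ^+ 2 - i%:R ^+ 2| :> R.
    by nra.
  rewrite [d%:R ^+ 3]exprSr -mulrA ler_pM2l ?exprn_gt0 // expr2.
  by apply: ler_pM; rewrite ?ler0n ?ler_nat.
have g4 : 4 <= g.
  apply: le_trans gl; rewrite -mulrA ler_peMr // ler_pdivlMr // mul1r.
  by rewrite -!natrX ler_nat leq_sqr.
(* Rounding two reals down shortens their distance by at most one, while [g >= 4]. *)
have gd : g - 1 <= `|rj - ri|.
  have floor_dist (x y u v : R) : x < u + 1 -> u <= x -> y < v + 1 -> v <= y ->
      `|x - y| - 1 <= `|u - v|.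
    by case: (ger0P (x - y)) => ?; case: (ger0P (u - v)) => ?; lra.
  exact: floor_dist.
split.
  by apply/eqP => e; move: gd; rewrite /rj /ri e subrr normr0; lra.
have -> : j%:R ^+ 2 / `|j%:R ^+ 2 - i%:R ^+ 2| = b / g.
  by rewrite gE /b; field; rewrite !gt_eqF ?ltr0n.
apply: (@le_trans _ _ (b / (g - 1))).
  apply: ler_pM; rewrite ?invr_ge0 ?normr_ge0 ?ler0n //.
  by rewrite lef_pV2 ?posrE; lra.
have gi : 2 / g <= i%:R ^+ 2 / (2 * d%:R ^+ 2).
  rewrite ler_pdivrMr; last by lra.
  rewrite mulrAC ler_pdivlMr ?mulr_gt0 ?exprn_gt0 //.
  by move: gl; rewrite ler_pdivrMr //; lra.
have b0 : 0 <= b / g by rewrite !divr_ge0 ?mulr_ge0 ?exprn_ge0 ?ler0n //; lra.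
(* [1 / (g - 1) <= (1 + 2 / g) / g] as soon as [g >= 2]. *)
apply: (@le_trans _ _ (b / g * (1 + 2 / g))); last first.
  by rewrite ler_wpM2l // lerD2l.
have b0' : 0 <= b by rewrite !divr_ge0 ?mulr_ge0 ?exprn_ge0 ?ler0n.
rewrite -mulrA ler_wpM2l //.
have -> : g^-1 * (1 + 2 / g) = (g + 2) / g ^+ 2 by field; lra.
rewrite ler_pdivlMr ?exprn_gt0; try lra.
rewrite mulrC ler_pdivrMr; last by lra.
by nra.
Qed.

(** The product is the absolute value at [0] of the [i]-th Lagrange basis polynomial for the points
    [1 / node d j]. Without rounding it is at most [2 exp(- i^2 / (2d))]; the rounding factors
    contribute at most [exp(d c) = exp(i^2 / (2d))], so the exponentials cancel. *)
Lemma prod_node_ratio (R : realType) (d i : nat) : (0 < i <= d)%N ->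
  \prod_(1 <= j < d.+1 | j != i)
     ((node d i)%:R / `|(node d j)%:R - (node d i)%:R|) <= 2 :> R.
Proof.
move=> id; have d0 : (0 < d)%N by lia.
set c : R := i%:R ^+ 2 / (2 * d%:R ^+ 2).
have c0 : 0 <= c by rewrite divr_ge0 ?mulr_ge0 ?exprn_ge0 ?ler0n.
apply: (@le_trans _ _ (\prod_(1 <= j < d.+1 | j != i)
    (j%:R ^+ 2 / `|j%:R ^+ 2 - i%:R ^+ 2| * (1 + c)))).
  rewrite big_nat_cond [leRHS]big_nat_cond; apply: ler_prod => j /andP[jd ji].
  rewrite divr_ge0 ?normr_ge0 ?ler0n //=.
  by have [] := node_dist_ratio R id jd ji.
rewrite big_split /= prod_square_nodes //.
have /(le_trans _)-> // : 2 * expR (- (d%:R * c)) * expR (d%:R * c) <= 2 :> R.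
  by rewrite -mulrA -expRD addNr expR0 mulr1.
apply: ler_pM.
- by rewrite !(mulr_ge0, exprn_ge0, invr_ge0, ler0n).
- by apply: prodr_ge0 => j _; rewrite addr_ge0.
- rewrite ler_pM2l //; have /andP[_ id'] := id.
  have -> : d%:R * c = i%:R ^+ 2 / (2 * d%:R).
    by rewrite /c; field; rewrite pnatr_eq0; lia.
  exact: central_ratio_le.
(* Filling in the omitted index [j = i] adds a factor at least [1] and gives exactly [d] factors. *)
- apply: (@le_trans _ _ (\prod_(1 <= j < d.+1) expR c)); last first.
    by rewrite prodr_const_nat subSS subn0 expRM_natl.
  rewrite big_mkcond /= big_nat_cond [leRHS]big_nat_cond.
  apply: ler_prod => j _.
  case: ifP => _; first by rewrite addr_ge0 //= expR_ge1Dx.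
  by rewrite ler01 /= -expR0 ler_expR.
Qed.

Lemma sum_inv_sq_le (R : realFieldType) (d : nat) :
  \sum_(1 <= i < d.+1) (i%:R ^+ 2)^-1 <= 2 :> R.
Proof.
(* The stronger bound [2 - 1/d] carries the induction; at [d = 0] the inverse is [0] by
   convention. *)
suff : \sum_(1 <= i < d.+1) (i%:R ^+ 2)^-1 <= 2 - d%:R^-1 :> R.
  by move/le_trans; apply; rewrite lerBlDr lerDl invr_ge0.
elim: d => [|[|d] IHd]; first by rewrite big_nil invr0; lra.
  by rewrite big_nat1 expr1n invr1; lra.
rewrite big_nat_recr //= (le_trans (lerD IHd (lexx _))) //.
rewrite -[d.+2%:R]natr1; set x := d.+1%:R.
have x0 : 0 < x by [].
rewrite -subr_ge0.
have -> : 2 - (x + 1)^-1 - (2 - x^-1 + ((x + 1) ^+ 2)^-1) =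
    (x * (x + 1) ^+ 2)^-1.
  by move: x0; rewrite {}/x => x0; field; rewrite !nat1r natr1 !pnatr_eq0.
by rewrite invr_ge0 mulr_ge0 ?exprn_ge0 // ltW ?addr_gt0.
Qed.

Lemma node_inj (d i j : nat) : (0 < i <= d)%N -> (0 < j <= d)%N ->
  node d i = node d j -> i = j.
Proof.
move=> id jd e; have [//|] := eqVneq i j => ij.
by have [] := node_dist_ratio rat jd id ij; rewrite e eqxx.
Qed.

(** Divide [p - p(1/m)] by [X - 1/m]. The quotient [q] is at most [2 * node d i] at the [i]-th
    point, and interpolation with weights at most [2] gives [|q(w)| <= 32 d^3]; finally
    [w - 1/m <= 2/m]. The hypothesis on [m./2] places all nodes at or below [m./2]. *)
Lemma poly_reciprocal_drop (R : realType) (p : {poly R}) (d m : nat) :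
  (0 < d)%N -> (size p <= d.+1)%N -> (4 * d ^ 3 <= m./2)%N ->
  (forall r : nat, (0 < r <= m)%N -> 0 <= p.[r%:R^-1] <= 1) ->
  `|p.[(m./2)%:R^-1] - p.[m%:R^-1]| <= 64 * d%:R ^+ 3 / m%:R.
Proof.
move=> d0 szp dm p01; set w := _^-1; set z0 := m%:R^-1.
have d30 : (0 < d ^ 3)%N by rewrite expn_gt0 d0.
have m0 : 0 < m%:R :> R by rewrite ltr0n; lia.
have M0 : 0 < (m./2)%:R :> R by rewrite ltr0n; lia.
have wz0 : 2 * z0 <= w.
  by rewrite /w /z0 ler_pdivrMr // ler_pdivlMl // -natrM ler_nat; lia.
have wz1 : w <= 3 * z0.
  by rewrite /w /z0 ler_pdivlMr // ler_pdivrMl // -natrM ler_nat; lia.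
have z00 : 0 < z0 by rewrite invr_gt0.
pose z (i : 'I_d) : R := (node d i.+1)%:R^-1.
have id (i : 'I_d) : (0 < i.+1 <= d)%N by rewrite /= ltn_ord.
have n0 (i : 'I_d) : 0 < (node d i.+1)%:R :> R by rewrite ltr0n node_gt0.
have nm (i : 'I_d) : (node d i.+1 <= m./2)%N.
  by rewrite (leq_trans (leq_div _ _)).
have wz (i : 'I_d) : w <= z i.
  by rewrite lef_pV2 ?posrE ?n0 ?ler_nat.
have z_inj : injective z.
  move=> i j /invr_inj /eqP; rewrite eqr_nat => /eqP /node_inj e.
  by apply/val_inj/succn_inj/e.
have /factor_theorem[q qE] : root (p - p.[z0]%:P) z0.
  by rewrite rootE !hornerE subrr.
have qEx x : p.[x] - p.[z0] = q.[x] * (x - z0).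
  by have := congr1 (horner^~ x) qE; rewrite !hornerE.
have szq : (size q <= d)%N.
  have [->|q0] := eqVneq q 0; first by rewrite size_poly0.
  have: (size (p - p.[z0]%:P)%R <= d.+1)%N.
    rewrite (leq_trans (size_polyD _ _)) // geq_max szp size_polyN.
    by rewrite (leq_trans (size_polyC_leq1 _)).
  by rewrite qE size_Mmonic ?monicXsubC // size_XsubC addn2.
(* [p] varies by at most [1], and [z i >= w >= 2 z0] gives [z i - z0 >= z i / 2]. *)
have qz (i : 'I_d) : `|q.[z i]| <= 2 * (node d i.+1)%:R.
  have zi : 0 < z i - z0 by have := wz i; lra.
  have zi2 : (z i)^-1 = (node d i.+1)%:R by rewrite invrK.
  rewrite -(ler_pM2r zi) -[X in _ * X <= _]gtr0_norm // -normrM -qEx.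
  apply: (@le_trans _ _ 1).
    have /p01/andP[? ?] : (0 < node d i.+1 <= m)%N.
      by rewrite node_gt0 //= (leq_trans (nm i)) // leq_half_double; lia.
    have /p01/andP[? ?] : (0 < m <= m)%N by rewrite leqnn -(ltr0n R) m0.
    by rewrite ler_norml /z /z0; lra.
  rewrite -zi2 -mulrA mulrC -mulrA ler_pdivlMl ?mulr1; last by rewrite invr_gt0.
  have := wz i; lra.
have qw : `|q.[w]| <= 32 * d%:R ^+ 3.
  rewrite (lagrange_eval w z_inj szq).
  apply: le_trans (ler_norm_sum _ _ _) _.
  apply: (@le_trans _ _ (\sum_(i < d) (16 * d%:R ^+ 3) * (i.+1%:R ^+ 2)^-1)).
    apply: ler_sum => i _; rewrite normrM.
    apply: (@le_trans _ _ (2 * (node d i.+1)%:R * 2)); last first.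
      have := node_le R d (ltn0Sn i).
      by move: (_ ^+ 3) (_ ^- 2) (node _ _)%:R => u v k; lra.
    apply: ler_pM => //; rewrite normr_prod.
    apply: le_trans (prod_node_ratio R (id i)).
    rewrite big_add1 big_mkord /=; apply: ler_prod => j ji.
    rewrite normr_ge0 normrM normfV /=.
    (* As [0 < w <= z j], the weight at [w] is bounded by the one at [0]. *)
    apply: (@le_trans _ _ (z j / `|z i - z j|)).
      rewrite ler_wpM2r ?invr_ge0 // ler_norml.
      have := wz j; lra.
    rewrite le_eqVlt; apply/orP; left; apply/eqP.
    have -> : z i - z j = ((node d j.+1)%:R - (node d i.+1)%:R) * (z i * z j).
      by rewrite /z; field; rewrite !gt_eqF ?n0.
    rewrite normrM [`|z i * _|]gtr0_norm ?mulr_gt0 ?invr_gt0 ?n0 //.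
    have [dne _] := node_dist_ratio R (id i) (id j) ji.
    rewrite /z; field; rewrite !gt_eqF ?n0 // normr_gt0.
    by rewrite subr_eq0 eqr_nat.
  rewrite -mulr_sumr -[32]/(16 * 2)%:R natrM [leRHS]mulrAC.
  rewrite ler_wpM2l ?mulr_ge0 ?exprn_ge0 //.
  by have := sum_inv_sq_le R d; rewrite big_add1 big_mkord.
rewrite qEx normrM [`|w - z0|]gtr0_norm; last by lra.
apply: (@le_trans _ _ (32 * d%:R ^+ 3 * (2 * z0))); last by rewrite /z0; lra.
by apply: ler_pM => //; lra.
Qed.

(** * Counting regular functions that extend a partial function *)

(** A list of constraints, possibly repeated or contradictory, stands for a partial function, so
    that a product of monomials is a concatenation. *)
Definition agrees (n m : nat) (f : 'I_n -> 'I_m)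
    (s : seq ('I_n * 'I_m)) : bool :=
  all (fun u => f u.1 == u.2) s.

(** Parametrised by the fibre size [K]; the range [r] is recovered from [n = r * K] in
    [card_used]. *)
Definition regular_funs (n m K : nat) : {set {ffun 'I_n -> 'I_m}} :=
  [set f : {ffun 'I_n -> 'I_m} |
    [forall y, #|[set x | f x == y]| \in [:: 0%N; K]]].

Definition regular_ext (n m K : nat) (s : seq ('I_n * 'I_m)) :=
  [set f in regular_funs n m K | agrees f s].

Lemma regular_ext0 (n m K : nat) :
  regular_ext K [::] = regular_funs n m K.
Proof. by apply/setP => f; rewrite inE andbT. Qed.

Section Counting.
Local Open Scope nat_scope.
Variables (n m K r : nat).
Hypotheses (K0 : 0 < K) (nE : n = r * K).
Implicit Types (s : seq ('I_n * 'I_m)) (f : {ffun 'I_n -> 'I_m}).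

Local Notation ext := (@regular_ext n m K).

Lemma regular_fiber f y : f \in regular_funs n m K ->
  #|[set x | f x == y]| = if [exists x, f x == y] then K else 0.
Proof.
rewrite inE => /forallP/(_ y); rewrite !inE; case: existsP => [[x fx]|fy].
  case/orP=> [|/eqP//]; rewrite cards_eq0 => /eqP/setP/(_ x).
  by rewrite !inE fx.
move=> _; apply/eqP; rewrite cards_eq0; apply/eqP/setP => x; rewrite !inE.
by apply/negP => fx; apply: fy; exists x.
Qed.

Lemma card_used f : f \in regular_funs n m K ->
  #|[set y | [exists x, f x == y]]| = r.
Proof.
move=> fK; apply/eqP; rewrite -(eqn_pmul2r K0) -nE -sum_nat_const; apply/eqP.
rewrite -[RHS]card_ord -sum1_card (partition_big f predT) //=.
rewrite big_mkcond /=; apply: eq_bigr => y _.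
by rewrite inE sum1dep_card regular_fiber.
Qed.

Lemma agrees_mem s f x y : agrees f s -> (x, y) \in s -> f x = y.
Proof. by move=> /allP a /a/eqP. Qed.

Lemma regular_precomp f (x x' : 'I_n) :
  f \in regular_funs n m K ->
  [ffun z => f (tperm x x' z)] \in regular_funs n m K.
Proof.
rewrite !inE => /forallP fK; apply/forallP => y.
rewrite -(card_imset _ (@perm_inj _ (tperm x x'))).
rewrite (_ : imset _ _ = [set z | f z == y]) ?fK //.
apply/setP => z; rewrite -[z in LHS](tpermK x x').
rewrite mem_imset; last exact: perm_inj.
by rewrite !inE ffunE tpermK.
Qed.

Lemma regular_postcomp f (y y' : 'I_m) :
  f \in regular_funs n m K ->
  [ffun z => tperm y y' (f z)] \in regular_funs n m K.
Proof.
rewrite !inE => /forallP fK; apply/forallP => z.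
rewrite (_ : [set _ | _] = [set x | f x == tperm y y' z]) ?fK //.
apply/setP => x; rewrite !inE ffunE.
by rewrite -(inj_eq (@perm_inj _ (tperm y y'))) tpermK.
Qed.

(** Precomposing with the transposition of [x] and [x'] is injective and moves only unconstrained
    points. *)
Lemma card_ext_swap_dom s x x' y : x \notin unzip1 s -> x' \notin unzip1 s ->
  #|[set f in ext s | f x == y]| = #|[set f in ext s | f x' == y]|.
Proof.
wlog suff le : x x' / x \notin unzip1 s -> x' \notin unzip1 s ->
    #|[set f in ext s | f x == y]| <= #|[set f in ext s | f x' == y]|.
  by move=> xs x's; apply/eqP; rewrite eqn_leq !le.
move=> xs x's.
pose g f := [ffun z => f (tperm x x' z)].
have g_inj : injective g.
  move=> f1 f2 /ffunP e; apply/ffunP => z.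
  by have := e (tperm x x' z); rewrite !ffunE tpermK.
rewrite -(card_imset _ g_inj); apply: subset_leq_card.
apply/subsetP => _ /imsetP[f + ->]; rewrite !inE ffunE tpermR -!andbA.
move=> /and3P[fK fs ->]; have := @regular_precomp f x x'; rewrite !inE => -> //.
rewrite andbT /=; apply/allP => -[a b] ab; rewrite ffunE /= tpermD.
- by move/allP: fs => /(_ _ ab).
- by apply: contraNneq xs => ->; apply/mapP; exists (a, b).
- by apply: contraNneq x's => ->; apply/mapP; exists (a, b).
Qed.

Lemma card_ext_swap_cod s y y' : y \notin unzip2 s -> y' \notin unzip2 s ->
  #|[set f in ext s | [exists x, f x == y]]| =
  #|[set f in ext s | [exists x, f x == y']]|.
Proof.
wlog suff le : y y' / y \notin unzip2 s -> y' \notin unzip2 s ->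
    #|[set f in ext s | [exists x, f x == y]]| <=
    #|[set f in ext s | [exists x, f x == y']]|.
  by move=> ys y's; apply/eqP; rewrite eqn_leq !le.
move=> ys y's.
pose g f := [ffun z => tperm y y' (f z)].
have g_inj : injective g.
  move=> f1 f2 /ffunP e; apply/ffunP => z.
  by have := e z; rewrite !ffunE => /perm_inj.
rewrite -(card_imset _ g_inj); apply: subset_leq_card.
apply/subsetP => _ /imsetP[f + ->]; rewrite !inE -!andbA.
move=> /and3P[fK fs /existsP[x /eqP fx]].
have := @regular_postcomp f y y'; rewrite !inE => -> //=.
apply/andP; split; last by apply/existsP; exists x; rewrite ffunE fx tpermL.
apply/allP => -[a b] ab; rewrite ffunE /=.
move/allP: fs => /(_ _ ab) /= /eqP ->; rewrite tpermD //.
- by apply: contraNneq ys => ->; apply/mapP; exists (a, b).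
- by apply: contraNneq y's => ->; apply/mapP; exists (a, b).
Qed.

Definition dom s := [set x | x \in unzip1 s].
Definition cod s := [set y | y \in unzip2 s].

(** Double counting of the pairs [(f, z)] with [f z = y]. All [z] outside [dom s] contribute equally
    by symmetry; a [z] in [dom s] contributes every extension or none. *)
Lemma sum_card_fiber s x y : x \notin unzip1 s ->
  \sum_(f in ext s) #|[set z | f z == y]| =
  #|ext ((x, y) :: s)| * (n - #|dom s|) + #|ext s| * #|[set z | (z, y) \in s]|.
Proof.
move=> xs.
under eq_bigr => f _ do rewrite -sum1dep_card.
rewrite (exchange_big_dep predT) //= (bigID (mem (dom s))) /= addnC.
have cardE z : \sum_(f in ext s | f z == y) 1 = #|[set f in ext s | f z == y]|.
  by rewrite sum1dep_card; apply: eq_card => f; rewrite !inE.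
under eq_bigr => z _ do rewrite cardE.
under [in X in _ + X]eq_bigr => z _ do rewrite cardE.
congr (_ + _).
  rewrite (eq_bigr (fun=> #|ext ((x, y) :: s)|)) => [|z]; last first.
    rewrite inE => zs; rewrite (card_ext_swap_dom y zs xs).
    by apply: eq_card => f; rewrite !inE /= -!andbA [(f x == y) && _]andbC.
  rewrite sum_nat_const mulnC; congr (_ * _).
  have -> : n - #|dom s| = #|~: dom s|.
    by rewrite [in RHS]cardsCs setCK card_ord.
  by apply: eq_card => z; rewrite [RHS]in_setC.
rewrite mulnC -sum_nat_const [RHS]big_mkcond [LHS]big_mkcond.
apply: eq_bigr => z _; rewrite !inE.
case: ifP => [|zs]; last first.
  by case: ifP => // zy; move: zs; rewrite (map_f fst zy).
move=> /mapP[[a b] ab /= ->]; case: ifP => [ay|/negP ay].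
  apply: eq_card => f; rewrite !inE -!andbA.
  case: (boolP (agrees _ _)) => // fs.
  by rewrite (agrees_mem fs ay) eqxx.
apply/eqP; rewrite cards_eq0; apply/eqP/setP => f; rewrite !inE.
apply/negP => /andP[/andP[_ fs] /eqP fay]; apply: ay.
by rewrite -fay (agrees_mem fs ab).
Qed.

(* By symmetry, [f x = y] is equally likely for all [x] outside [dom s], so its
   probability is read off the number of [x] outside [dom s] mapped to [y]. *)
Lemma card_ext_old s x y : x \notin unzip1 s -> y \in unzip2 s ->
  #|ext ((x, y) :: s)| * (n - #|dom s|) + #|ext s| * #|[set z | (z, y) \in s]| =
  #|ext s| * K.
Proof.
move=> xs /mapP[[a b] ab /= ->]; rewrite -sum_card_fiber // -sum_nat_const.
apply: eq_bigr => f; rewrite inE => /andP[fK fs]; rewrite regular_fiber //.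
by case: existsP => // -[]; exists a; rewrite (agrees_mem fs ab).
Qed.

(* [u] counts the extensions having [y] in their range; by symmetry it does not
   depend on [y] outside [cod s]. *)
Lemma card_ext_new s x y : x \notin unzip1 s -> y \notin unzip2 s ->
  exists u, #|ext ((x, y) :: s)| * (n - #|dom s|) = u * K /\
    u * (m - #|cod s|) + #|ext s| * #|cod s| = #|ext s| * r.
Proof.
move=> xs ys; exists #|[set f in ext s | [exists x, f x == y]]|; split.
  have := sum_card_fiber y xs.
  have -> : [set z | (z, y) \in s] = set0.
    apply/setP => z; rewrite !inE; apply: contraNF ys => zy.
    by apply/mapP; exists (z, y).
  rewrite cards0 muln0 addn0 => <-.
  rewrite -sum_nat_const [RHS]big_mkcond [LHS]big_mkcond; apply: eq_bigr => f _.
  rewrite [in RHS]inE; case: ifP => //=; rewrite inE => /andP[fK _].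
  exact: regular_fiber.
(* Double counting of the pairs of an extension and one of its [r] values; each value in [cod s] is
   taken by every extension. *)
have -> : #|ext s| * r = \sum_(f in ext s) #|[set z | [exists x, f x == z]]|.
  rewrite -sum_nat_const; apply: eq_bigr => f; rewrite inE => /andP[fK _].
  by rewrite card_used.
under [RHS]eq_bigr => f _ do rewrite -sum1dep_card.
rewrite (exchange_big_dep predT) //= [RHS](bigID (mem (cod s))) /= addnC.
have cardE z : \sum_(f in ext s | [exists x, f x == z]) 1 =
    #|[set f in ext s | [exists x, f x == z]]|.
  by rewrite sum1dep_card.
under [in X in _ = X + _]eq_bigr => z _ do rewrite cardE.
under [in X in _ = _ + X]eq_bigr => z _ do rewrite cardE.
congr (_ + _).
  rewrite mulnC -sum_nat_const; apply: eq_bigr => z.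
  rewrite inE => /mapP[[a b] ab /= ->]; apply/esym/eq_card => f.
  rewrite [LHS]inE; case: (boolP (f \in ext s)) => //.
  rewrite !inE => /andP[_ fs]; apply/existsP; exists a.
  by rewrite (agrees_mem fs ab).
rewrite (eq_bigr (fun=> #|[set f in ext s | [exists x, f x == y]]|)) => [|z];
    last first.
  by rewrite inE => zs; rewrite (card_ext_swap_cod zs ys).
rewrite sum_nat_const mulnC; congr (_ * _).
have -> : m - #|cod s| = #|~: cod s| by rewrite [in RHS]cardsCs setCK card_ord.
by apply: eq_card => z; rewrite [LHS]in_setC.
Qed.
End Counting.

(** Induction on the constraints. With [K = n / r], [a = n - #|dom s|] and [b = m - #|cod s|], a
    constraint at a new point multiplies the proportion by [(n/r - c) / a] if its value occurs
    [c > 0] times in [s], and by [n (1 - #|cod s| / r) / (a b)] if the value is new: both are affine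
    in [1 / r]. One polynomial thus serves all factorisations of [n]. *)
Lemma regular_moment (R : realFieldType) (n m : nat) (s : seq ('I_n * 'I_m)) :
  exists2 p : {poly R}, (size p <= (size s).+1)%N &
  forall r K : nat, (0 < K)%N -> (0 < r)%N -> n = (r * K)%N ->
    #|regular_ext K s|%:R = p.[r%:R^-1] * #|regular_funs n m K|%:R.
Proof.
elim: s => [|[x y] s [p szp pE]].
  exists 1 => [|r K _ _ _]; first by rewrite size_poly1.
  by rewrite regular_ext0 hornerE mul1r.
have szpM (q : {poly R}) : (size q <= 2)%N -> (size (p * q)%R <= (size s).+2)%N.
  by move=> szq; rewrite (leq_trans (size_polyMleq _ _)) //; lia.
have szlin (a b : R) : (size (a *: 'X + b%:P)%R <= 2)%N.
  rewrite (leq_trans (size_polyD _ _)) // geq_max.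
  rewrite (leq_trans (size_scale_leq _ _)) ?size_polyX //.
  by rewrite (leq_trans (size_polyC_leq1 _)).
have szZ a (q : {poly R}) :
    (size q <= (size s).+2)%N -> (size (a *: q)%R <= (size s).+2)%N.
  by apply: leq_trans; apply: size_scale_leq.
have [xs|xs] := boolP (x \in unzip1 s).
  have [xys|xys] := boolP ((x, y) \in s).
    exists p => [|r K K0 r0 nE]; first by rewrite ltnW.
    rewrite -(pE r) //; congr _%:R; apply: eq_card => f; rewrite !inE /=.
    case: (boolP (agrees f s)) => [fs|]; last by rewrite andbF.
    by rewrite (agrees_mem fs xys) eqxx.
  exists 0 => [|r K K0 r0 nE]; first by rewrite size_poly0.
  rewrite hornerE mul0r; apply/eqP; rewrite pnatr_eq0 cards_eq0.
  apply/eqP/setP => f; rewrite !inE /=; apply/negP => /and3P[_ /eqP fx fs].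
  case/mapP: xs xys fx => -[a b] ab /= -> + fx; rewrite -fx.
  by rewrite (agrees_mem fs ab) ab.
have xdom : (0 < n - #|dom s|)%N.
  rewrite subn_gt0 -[X in (_ < X)%N]card_ord -cardsT; apply: proper_card.
  by rewrite properE subsetT; apply/subsetPn; exists x; rewrite ?inE.
set a := (n - _)%N in xdom.
have a0 : a%:R != 0 :> R by rewrite pnatr_eq0 -lt0n.
have KE r K : (0 < r)%N -> n = (r * K)%N -> K%:R = n%:R * r%:R^-1 :> R.
  by move=> r0 ->; rewrite natrM mulrAC divff ?mul1r // pnatr_eq0 -lt0n.
have [ys|ys] := boolP (y \in unzip2 s).
  pose c := #|[set z | (z, y) \in s]|.
  exists (a%:R^-1 *: (p * (n%:R *: 'X + (- c%:R)%:P))).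
    exact/szZ/szpM/szlin.
  move=> r K K0 r0 nE; rewrite hornerZ hornerM hornerD hornerZ hornerX hornerC.
  have := card_ext_old K xs ys.
  move=> /(congr1 (fun k => k%:R : R)); rewrite !(natrD, natrM) -/a -/c.
  move=> /(canRL (addrK _)) e; apply: (mulIf a0).
  by rewrite e (KE r K) // (pE r) //; field; rewrite a0 pnatr_eq0 -lt0n r0.
have ycod : (0 < m - #|cod s|)%N.
  rewrite subn_gt0 -[X in (_ < X)%N]card_ord -cardsT; apply: proper_card.
  by rewrite properE subsetT; apply/subsetPn; exists y; rewrite ?inE.
set b := (m - _)%N in ycod.
have b0 : b%:R != 0 :> R by rewrite pnatr_eq0 -lt0n.
exists ((n%:R / (a%:R * b%:R)) *: (p * ((- #|cod s|%:R) *: 'X + 1%:P))).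
  exact/szZ/szpM/szlin.
move=> r K K0 r0 nE; rewrite hornerZ hornerM hornerD hornerZ hornerX hornerC.
have [u []] := card_ext_new K0 nE xs ys.
move=> /(congr1 (fun k => k%:R : R)); rewrite !natrM -/a (KE r K) // => e1.
move=> /(congr1 (fun k => k%:R : R)); rewrite !(natrD, natrM) -/b (pE r K) //.
have r0' : r%:R != 0 :> R by rewrite pnatr_eq0 -lt0n.
move=> /(canRL (addrK _)) e2.
apply: (mulIf a0); rewrite e1; apply: (mulIf b0).
rewrite mulrAC e2; field.
by rewrite a0 b0 r0'.
Qed.

(** The function [x mod r] takes each value below [r] exactly [K] times. *)
Lemma regular_funs_neq0 (n m r K : nat) : (0 < K)%N -> (r <= m)%N ->
  n = (r * K)%N -> (0 < #|regular_funs n m K|)%N.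
Proof.
move=> K0 rm ->.
have r0 (x : 'I_(r * K)) : (0 < r)%N by have := ltn_ord x; lia.
have xm (x : 'I_(r * K)) : (x %% r < m)%N.
  by rewrite (leq_trans _ rm) // ltn_mod (r0 x).
rewrite card_gt0; apply/set0Pn; exists [ffun x => Ordinal (xm x)].
rewrite inE; apply/forallP => y; rewrite !inE.
have [yr|ry] := ltnP y r.
  apply/orP; right.
  have kr (k : 'I_K) : (k * r + y < r * K)%N by have := ltn_ord k; nia.
  pose g k : 'I_(r * K) := Ordinal (kr k).
  have g_inj : injective g.
    move=> k k' /(congr1 val) /= /eqP; rewrite eqn_add2r.
    by rewrite eqn_pmul2r ?(leq_ltn_trans _ yr) // => /eqP/val_inj.
  rewrite -[X in _ == X]card_ord -[X in _ == X]cardsT -(card_imset _ g_inj).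
  apply/eqP/eq_card => x; rewrite !inE ffunE.
  apply/eqP/imsetP => [/(congr1 val) /= e|[k _ ->]].
    have xK : (x %/ r < K)%N.
      by rewrite ltn_divLR ?(r0 x) // [X in (_ < X)%N]mulnC.
    exists (Ordinal xK) => //; apply: val_inj => /=; rewrite -e; exact: divn_eq.
  by apply: val_inj => /=; rewrite modnMDl modn_small.
apply/orP; left; rewrite cards_eq0; apply/eqP/setP => x; rewrite !inE ffunE.
apply/negP => /eqP/(congr1 val) /= xy.
by have := ltn_pmod x (r0 x); rewrite xy ltnNge ry.
Qed.

(** * Polynomials in the indicators and their means over regular functions *)

(** A product of indicators [f x = y] is again an indicator [agrees f s], so [L] lists monomials
    with their coefficients. *)
Definition fun_deg (C : numClosedFieldType) (n m k : nat)
    (Phi : ('I_n -> 'I_m) -> C) : Prop :=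
  exists2 L : seq (C * seq ('I_n * 'I_m)), all (fun u => size u.2 <= k)%N L &
    forall f, Phi f = \sum_(u <- L) u.1 * (agrees f u.2)%:R.

Section FunDeg.
Variables (C : numClosedFieldType) (n m : nat).
Implicit Types Phi Psi : ('I_n -> 'I_m) -> C.
Local Notation deg := (@fun_deg C n m).

Lemma eq_fun_deg k Phi Psi : Phi =1 Psi -> deg k Phi -> deg k Psi.
Proof. by move=> e [L szL PhiE]; exists L => // f; rewrite -e. Qed.

Lemma fun_deg_cst k c : deg k (fun=> c).
Proof. by exists [:: (c, [::])] => // f; rewrite big_seq1 mulr1. Qed.

Lemma fun_deg_eq x y : deg 1 (fun f => (f x == y)%:R).
Proof.
by exists [:: (1, [:: (x, y)])] => // f; rewrite big_seq1 mul1r /= andbT.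
Qed.

Lemma fun_degD k Phi Psi :
  deg k Phi -> deg k Psi -> deg k (fun f => Phi f + Psi f).
Proof.
move=> [L szL PhiE] [L' szL' PsiE]; exists (L ++ L').
  by rewrite all_cat szL.
by move=> f; rewrite big_cat PhiE PsiE.
Qed.

Lemma fun_deg_sum k (I : finType) (P : pred I) (F : I -> ('I_n -> 'I_m) -> C) :
  (forall i, deg k (F i)) -> deg k (fun f => \sum_(i | P i) F i f).
Proof.
move=> degF; elim: (index_enum I) => [|i r IHr].
  by apply: eq_fun_deg (fun_deg_cst k 0) => f; rewrite big_nil.
case Pi: (P i); last by apply: eq_fun_deg IHr => f; rewrite big_cons Pi.
by apply: eq_fun_deg (fun_degD (degF i) IHr) => f; rewrite big_cons Pi.
Qed.

Lemma fun_degM j k Phi Psi : deg j Phi -> deg k Psi ->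
  deg (j + k) (fun f => Phi f * Psi f).
Proof.
move=> [L szL PhiE] [L' szL' PsiE].
exists [seq (u.1 * v.1, u.2 ++ v.2) | u <- L, v <- L'].
  apply/allP => _ /allpairsP[[u v] [/(allP szL) uj /(allP szL') vk ->]] /=.
  by rewrite size_cat leq_add.
move=> f; rewrite PhiE PsiE big_allpairs_dep mulr_suml; apply: eq_bigr => u _.
rewrite mulr_sumr; apply: eq_bigr => v _ /=.
by rewrite /agrees all_cat -mulnb natrM mulrACA.
Qed.

(** Indicators are real, so conjugation affects only the coefficients. *)
Lemma fun_deg_norm2 k Phi : deg k Phi -> deg (k + k) (fun f => `|Phi f| ^+ 2).
Proof.
move=> degP; have degPc : deg k (fun f => (Phi f)^*).
  have [L szL PhiE] := degP; exists [seq (u.1^*, u.2) | u <- L].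
    by rewrite all_map.
  move=> f; rewrite PhiE rmorph_sum big_map; apply: eq_bigr => u _.
  by rewrite rmorphM rmorph_nat.
by apply: eq_fun_deg (fun_degM degP degPc) => f; rewrite normCK.
Qed.
End FunDeg.

(** Linearity reduces this to single monomials, settled by [regular_moment]; real parts of the
    complex coefficients yield a polynomial over [R]. *)
Lemma regular_sum_poly (R : realType) (n m k : nat)
    (Phi : ('I_n -> 'I_m) -> R[i]) : fun_deg k Phi ->
  exists2 p : {poly R}, (size p <= k.+1)%N &
  forall r K : nat, (0 < K)%N -> (0 < r)%N -> n = (r * K)%N ->
    \sum_(f in regular_funs n m K) complex.Re (Phi f) =
      p.[r%:R^-1] * #|regular_funs n m K|%:R.
Proof.
move=> [L szL PhiE]; elim: L => [|[c s] L IHL] in Phi szL PhiE *.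
  exists 0 => [|r K K0 r0 nE]; rewrite ?size_poly0 // hornerC mul0r.
  by rewrite big1 // => f _; rewrite PhiE big_nil.
have /andP[/= szs szL'] := szL.
have [p szp pE] := IHL _ szL' (fun f => erefl).
have [q szq qE] := regular_moment R s.
exists (complex.Re c *: q + p) => [|r K K0 r0 nE].
  rewrite (leq_trans (size_polyD _ _)) // geq_max szp andbT.
  by rewrite (leq_trans (size_scale_leq _ _)) // (leq_trans szq).
rewrite hornerD hornerZ mulrDl -pE // -mulrA.
rewrite -(qE r) // -sum1_card natr_sum mulr_sumr.
have -> : \sum_(f in regular_ext K s) complex.Re c * 1 =
    \sum_(f in regular_funs n m K) complex.Re c * (agrees f s)%:R.
  rewrite [RHS](bigID (fun f : {ffun 'I_n -> 'I_m} => agrees f s)) /=.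
  rewrite [X in _ = _ + X]big1 ?addr0 => [|f /andP[_ /negbTE->]]; last first.
    by rewrite mulr0.
  apply: eq_big => [f|f]; first by rewrite inE.
  by rewrite inE => /andP[_ ->].
rewrite -big_split; apply: eq_bigr => f _ /=; rewrite PhiE big_cons /=.
case: c {PhiE szL} => a b; case: agrees; case: (\sum_(u <- L) _) => a' b' /=;
  by rewrite ?(mulr0, mulr1, subr0, mul0r).
Qed.

(** * Degree and normalisation of quantum states *)

Lemma queryK (n m w : nat) (f : 'I_n -> 'I_m) : involutive (@query n m w f).
Proof.
move=> [[x b] v]; rewrite /query /=; congr (_, _, _).
by case: pickP => [i _|//]; apply/ffunP => j; rewrite !ffunE addbK.
Qed.

(** An entry depends on [f] only through its value at the point encoded in the query register, and
    is constant when no point is encoded. *)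
Lemma oracle_deg (R : realType) (n m w : nat) (s t : 'I_#|basis n m w|) :
  fun_deg 1 (fun f : 'I_n -> 'I_m => oracle R w f s t).
Proof.
case et : (enum_val t) => [[x b] v].
case px : [pick i : 'I_n | nbits (up_log 2 n) i == x] => [i|]; last first.
  apply: eq_fun_deg (fun_deg_cst _ _ _ (enum_val s == (x, b, v))%:R) => f.
  by rewrite mxE et /= px.
apply: (@eq_fun_deg _ _ _ _ (fun f => \sum_y (f i == y)%:R *
    (enum_val s == (x, bxor b (nbits (up_log 2 m) y), v))%:R)).
  move=> f; rewrite mxE et /= px (bigD1 (f i)) //= eqxx mul1r big1 ?addr0 //.
  by move=> y; rewrite eq_sym => /negbTE->; rewrite mul0r.
apply: fun_deg_sum => y; rewrite -[1%N]/(1 + 0)%N.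
by apply: fun_degM; [exact: fun_deg_eq | exact: fun_deg_cst].
Qed.

(** Gates do not depend on [f], so each query raises the degree by one. *)
Lemma qstate_deg (R : realType) (n m : nat) (A : qalg R n m) (t : nat) s :
  fun_deg t (fun f : 'I_n -> 'I_m => qstate A f t s 0).
Proof.
elim: t s => [|t IHt] s /=; first exact: fun_deg_cst.
apply: (@eq_fun_deg _ _ _ _ (fun f => \sum_j gate A t.+1 s j *
    (\sum_k oracle R (nwork A) f j k * qstate A f t k 0))).
  by move=> f; rewrite !mxE; apply: eq_bigr => j _; rewrite [in RHS]mxE.
apply: fun_deg_sum => j; rewrite -[t.+1]/(0 + (1 + t))%N.
apply: fun_degM; first exact: fun_deg_cst.
apply: fun_deg_sum => k; apply: fun_degM; last exact: IHt.
exact: oracle_deg.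
Qed.

Lemma outcome_prob_deg (R : realType) (n m : nat) (A : qalg R n m) S :
  fun_deg (nqueries A + nqueries A)
    (fun f : 'I_n -> 'I_m => outcome_prob (A := A) f S).
Proof. by apply: fun_deg_sum => s; apply: fun_deg_norm2; apply: qstate_deg. Qed.

Lemma unitary_norm2 (C : numClosedFieldType) (N : nat) (U : 'M[C]_N)
    (v : 'cV[C]_N) :
  U \is unitarymx -> \sum_i `|(U *m v) i 0| ^+ 2 = \sum_i `|v i 0| ^+ 2.
Proof.
have norm2E (u : 'cV[C]_N) :
    \sum_i `|u i 0| ^+ 2 = (map_mx Num.conj u^T *m u) 0 0.
  by rewrite mxE; apply: eq_bigr => i _; rewrite !mxE normCK mulrC.
move=> /unitarymxP /mulmx1C Uu; rewrite !norm2E trmx_mul map_mxM.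
by rewrite -mulmxA (mulmxA _ U) Uu mul1mx.
Qed.

(** The oracle permutes the coordinates along the involution [query f]. *)
Lemma oracle_norm2 (R : realType) (n m w : nat) (f : 'I_n -> 'I_m)
    (v : 'cV[R[i]]_#|basis n m w|) :
  \sum_s `|(oracle R w f *m v) s 0| ^+ 2 = \sum_s `|v s 0| ^+ 2.
Proof.
pose h (s : 'I_#|basis n m w|) : 'I_#|basis n m w| :=
  enum_rank (query f (enum_val s)).
have hK : involutive h by move=> s; rewrite /h enum_rankK queryK enum_valK.
rewrite [RHS](reindex_inj (inv_inj hK)).
apply: eq_bigr => s _; congr (`|_| ^+ 2).
rewrite mxE (bigD1 (h s)) //= mxE enum_rankK queryK eqxx mul1r.
rewrite big1 ?addr0 // => t ts.
rewrite mxE; case: eqP => [e|_]; last by rewrite mul0r.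
by rewrite /h e queryK enum_valK eqxx in ts.
Qed.

Lemma outcome_probC (R : realType) (n m : nat) (A : qalg R n m)
    (f : 'I_n -> 'I_m) S :
  outcome_prob (A := A) f S + outcome_prob (A := A) f (~: S) = 1.
Proof.
have st t : \sum_s `|qstate A f t s 0| ^+ 2 = 1.
  elim: t => [|t IHt] /=; rewrite unitary_norm2 ?gate_unitary ?oracle_norm2 //.
  set s0 := enum_rank _; rewrite (bigD1 s0) //= !mxE eqxx normr1 expr1n.
  rewrite big1 ?addr0 //.
  by move=> s ss0; rewrite mxE (negbTE ss0) normr0 expr0n.
rewrite -(st (nqueries A)) (reindex _ (onW_bij _ (@enum_rank_bij _))) /=.
rewrite [RHS](bigID (mem S)) /=; congr (_ + _).
by apply: eq_bigl => s; rewrite inE.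
Qed.

(** * From the drop to the query bound *)

(** The [r] values taken contribute [1/r - 1/m] each, the other [m - r] contribute [1/m] each. *)
Lemma regular_l1dist (R : realType) (n m r K : nat) (f : {ffun 'I_n -> 'I_m}) :
  (0 < K)%N -> (0 < r <= m)%N -> n = (r * K)%N -> f \in regular_funs n m K ->
  l1dist (fdist R f) (udist R m) = 2 * (1 - r%:R / m%:R).
Proof.
move=> K0 /andP[r0 rm] nE fK.
have m0 : m%:R != 0 :> R by rewrite pnatr_eq0; lia.
have rR : 0 < r%:R :> R by rewrite ltr0n.
have KR : K%:R != 0 :> R by rewrite pnatr_eq0 -lt0n.
pose U := [set y | [exists x, f x == y]].
have cU : #|U| = r by exact: (card_used K0 nE fK).
have cUC : #|~: U| = (m - r)%N by rewrite cardsCs setCK cU card_ord.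
rewrite /l1dist (bigID (mem U)) /=.
rewrite [X in _ + X](eq_bigl (mem (~: U))) => [|y]; last by rewrite [RHS]inE.
rewrite (eq_bigr (fun=> r%:R^-1 - m%:R^-1)) => [|y]; last first.
  rewrite inE => yf; rewrite !ffunE (regular_fiber _ fK) yf nE natrM.
  have -> : K%:R / (r%:R * K%:R) = r%:R^-1 :> R by field; rewrite KR gt_eqF.
  by rewrite ger0_norm // subr_ge0 lef_pV2 ?posrE ?ltr0n ?ler_nat //; lia.
rewrite [X in _ + X](eq_bigr (fun=> m%:R^-1)) => [|y]; last first.
  rewrite !inE => yf; rewrite !ffunE (regular_fiber _ fK) (negbTE yf).
  by rewrite mul0r sub0r normrN ger0_norm // invr_ge0.
rewrite !sumr_const cU cUC -[X in X + _]mulr_natr -[X in _ + X]mulr_natr.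
by rewrite natrB //; field; rewrite m0 gt_eqF.
Qed.

Lemma regular_uniform (R : realType) (n m K : nat) (f : {ffun 'I_n -> 'I_m}) :
  (0 < K)%N -> n = (m * K)%N -> f \in regular_funs n m K ->
  fdist R f = udist R m.
Proof.
move=> K0 nE fK; apply/ffunP => y; rewrite !ffunE (regular_fiber _ fK).
have m0 : (0 < m)%N by have := ltn_ord y; lia.
have -> : [exists x, f x == y].
  have /setP/(_ y) : [set z | [exists x, f x == z]] = setT.
    apply/eqP; rewrite eqEcard subsetT cardsT card_ord.
    by rewrite (card_used K0 nE fK) leqnn.
  by rewrite !inE.
by rewrite [in LHS]nE natrM; field; rewrite !pnatr_eq0 -!lt0n K0 m0.
Qed.

(** The divisibility hypothesis provides regular functions of every range up to [m]. The constant is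
    [3 * 64]: a drop of at least [1/3] is at most [64 d^3 / m]. *)
Lemma queries_ge (R : realType) (eps : R) (n m : nat) (A : qalg R n m) :
  (0 < n)%N -> (forall r, (0 < r <= m)%N -> r %| n)%N ->
  eps <= 1 -> (1 < m)%N -> decides_uniformity eps A ->
  (m <= 192 * (nqueries A + nqueries A).+1 ^ 3)%N.
Proof.
(* The degree is at most [2q]; the extra one keeps [d] positive when [q = 0]. *)
move=> n0 dvn eps1 m1 decA; set d := (_ + _).+1.
rewrite leqNgt; apply/negP => dm.
have d0 : (0 < d)%N by [].
have [p szp pE] := regular_sum_poly (@outcome_prob_deg _ _ _ A (accept A)).
pose acc (f : {ffun 'I_n -> 'I_m}) :=
  complex.Re (outcome_prob (A := A) f (accept A)).
have Nd r : (0 < r <= m)%N -> (n = r * (n %/ r))%N.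
  by move=> rm; rewrite mulnC divnK // dvn.
have Nd0 r : (0 < r <= m)%N -> (0 < n %/ r)%N.
  by move=> /Nd e; move: n0; rewrite {1}e muln_gt0 => /andP[].
(* [p.[1/r]] is an average of [acc], hence inherits any bounds valid for all regular functions of
   range [r]. *)
have mean r a b : (0 < r <= m)%N ->
    (forall f, f \in regular_funs n m (n %/ r) -> a <= acc f <= b) ->
    a <= p.[r%:R^-1] <= b.
  move=> /[dup] rm /andP[r0 r_m] ab.
  have N0 : 0 < #|regular_funs n m (n %/ r)|%:R :> R.
    by rewrite ltr0n (regular_funs_neq0 (Nd0 r rm) r_m (Nd r rm)).
  rewrite -(ler_pM2r N0) -[X in _ && X](ler_pM2r N0).
  rewrite -(pE r _ (Nd0 r rm) r0 (Nd r rm)).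
  rewrite !mulr_natr -!sumr_const; apply/andP; split;
    by apply: ler_sum => f /ab/andP[].
have accC f : acc f + complex.Re (outcome_prob (A := A) f (~: accept A)) = 1.
  have ReD (x y : R[i]) : complex.Re (x + y) = complex.Re x + complex.Re y.
    by case: x; case: y.
  by rewrite /acc -ReD outcome_probC.
have Re_ge0 (f : {ffun 'I_n -> 'I_m}) S :
    0 <= complex.Re (outcome_prob (A := A) f S).
  have : 0 <= outcome_prob (A := A) f S.
    by apply: sumr_ge0 => s _; rewrite exprn_ge0.
  by rewrite lecE => /andP[].
have acc01 f : 0 <= acc f <= 1.
  by rewrite Re_ge0 -(accC f) lerDl Re_ge0.
have Re_ge23 (z : R[i]) : 2 / 3 <= z -> 2 / 3 <= complex.Re z.
  have -> : 2 / 3 = real_complex R (2 / 3).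
    by rewrite rmorphM fmorphV !rmorph_nat.
  by rewrite lecE => /andP[].
have d3 : (0 < d ^ 3)%N by rewrite expn_gt0.
have dm2 : (4 * d ^ 3 <= m./2)%N by move: (d ^ 3)%N d3 dm => e; lia.
have szpd : (size p <= d.+1)%N by rewrite (leq_trans szp).
have drop := poly_reciprocal_drop d0 szpd dm2
  (fun r rm => mean r 0 1 rm (fun f _ => acc01 f)).
have /andP[pm _] : 2 / 3 <= p.[m%:R^-1] <= 1.
  have mm : (0 < m <= m)%N by lia.
  apply: mean => // f fm; have /andP[_ ->] := acc01 f; rewrite andbT.
  apply/Re_ge23/(decA f).1.
  exact: (regular_uniform _ (Nd0 _ mm) (Nd _ mm) fm).
(* At range [m./2] the distance [2 (1 - r/m)] is at least [1 >= eps], so rejection is forced. *)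
have /andP[_ pm2] : 0 <= p.[(m./2)%:R^-1] <= 1 / 3.
  have mm : (0 < m./2 <= m)%N by lia.
  apply: mean => // f fm; have /andP[-> _] := acc01 f => /=.
  suff : 2 / 3 <= complex.Re (outcome_prob (A := A) f (~: accept A)).
    by have := accC f; lra.
  apply/Re_ge23/(decA f).2; apply: le_trans eps1 _.
  rewrite (regular_l1dist _ (Nd0 _ mm) mm (Nd _ mm) fm).
  have : (m./2)%:R / m%:R <= 2^-1 :> R; last by lra.
  by rewrite ler_pdivrMr ?ltr0n ?ler_pdivlMl // -?natrM ?ler_nat; lia.
have mR : 0 < m%:R :> R by rewrite ltr0n; lia.
have : 192 * d%:R ^+ 3 < m%:R :> R by rewrite -natrX -natrM ltr_nat.
move: drop; rewrite ler_pdivlMr // distrC => drop dmR.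
have := ler_norm (p.[m%:R^-1] - p.[m./2%:R^-1]); nra.
Qed.

Theorem theorem1p2 (R : realType) (eps : R) (heps0 : 0 <= eps)
    (heps1 : eps <= 1) :
  exists c : R, 0 < c /\
  exists m0 : nat,
  forall A : (forall n m : nat, qalg R n m), uniformity_tester eps A ->
  forall m : nat, (m0 <= m)%N -> (0 < m)%N ->
  exists n : nat, (0 < n)%N /\ c * m%:R `^ 3^-1 <= (nqueries (A n m))%:R.
Proof.
(* For [q > 0], [192 (2q+1)^3 <= 192 (3q)^3 <= (18 q)^3], as [192 * 27 = 5184 <= 5832 = 18^3]. *)
exists 18^-1; split; first by rewrite invr_gt0.
(* With [q = 0] the bound would read [m <= 192], which the threshold [193] excludes; [m!] is
   divisible by every [r <= m]. *)
exists 193%N => A testA m m193 m0; exists m`!%N; split; first exact: fact_gt0.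
have mdvd r : (0 < r <= m)%N -> (r %| m`!)%N by exact: dvdn_fact.
have m1 : (1 < m)%N by exact: leq_trans m193.
have := queries_ge (fact_gt0 m) mdvd heps1 m1 (testA _ m (fact_gt0 m) m0).
set q := nqueries _ => mq.
have q0 : (0 < q)%N by case: (q) mq => [|//]; lia.
have {}mq : (m <= (18 * q) ^ 3)%N.
  apply: leq_trans mq _; rewrite expnMn.
  have /leq_trans-> // : (192 * (q + q).+1 ^ 3 <= 192 * (3 * q) ^ 3)%N.
    by rewrite leq_mul2l leq_exp2r //; lia.
  by rewrite expnMn mulnA leq_mul2r; apply/orP; right.
rewrite ler_pdivrMl // -natrM.
have -> : (18 * q)%:R = ((18 * q)%:R ^+ 3) `^ 3^-1 :> R.
  by rewrite -powR_mulrn ?ler0n // -powRrM divff ?powRr1 ?ler0n // pnatr_eq0.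
by rewrite ge0_ler_powR ?invr_ge0 ?nnegrE ?ler0n ?exprn_ge0 // -natrX ler_nat.
Qed.
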